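(* For integers $\ell\ge 2$ and $k\ge1$, $$\Xi(k,\ell)\le\max\Bigl\{\frac{\ell}{\ell-1}(k-2),\ k\Bigr\}.$$
   Context: All graphs are finite, simple and undirected. For a graph $G=(V,E)$ and $x\in V$, $N[x]=\{x\}\cup\{y: xy\in E\}$; for $X\subseteq V$, $N[X]=\bigcup_{x\in X}N[x]$ (so $N[\emptyset]=\emptyset$). A set $C\subseteq V$ is $(1,\le\ell)$-identifying if $N[X]\cap C\neq N[Y]\cap C$ for all distinct $X,Y\subseteq V$ with $|X|\le\ell$, $|Y|\le\ell$. For $n\ge k\ge1$ and $\ell\ge1$, $\mathfrak{Gr}(n,k,\ell)$ is the set of graphs on $n$ vertices in which every $k$-element subset of vertices is $(1,\le\ell)$-identifying. $\Xi(k,\ell)=\max\{n\ge k:\mathfrak{Gr}(n,k,\ell)\ne\emptyset\}$ (note the edgeless graph on $k$ vertices lies in $\mathfrak{Gr}(k,k,\ell)$). *)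

(* Defs.v *)
From mathcomp Require Import all_boot all_order all_algebra.

Set Implicit Arguments.
Unset Strict Implicit.
Unset Printing Implicit Defensive.

(* A graph on the vertex set V is given by its edge set, a set of 2-element   *)
(* subsets of V.                                                              *)
Definition simple_graph (V : finType) (E : {set {set V}}) : bool :=
  [forall e in E, #|e| == 2].

Definition clnbr (V : finType) (E : {set {set V}}) (x : V) : {set V} :=
  x |: [set y | [set x; y] \in E].

Definition clnbrs (V : finType) (E : {set {set V}}) (X : {set V}) : {set V} :=
  \bigcup_(x in X) clnbr E x.

Definition identifying (V : finType) (E : {set {set V}}) (l : nat)
    (C : {set V}) : bool :=
  [forall X : {set V}, forall Y : {set V},
    [&& X != Y, #|X| <= l & #|Y| <= l]
    ==> (clnbrs E X :&: C != clnbrs E Y :&: C)].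

(* Graphs on n vertices are taken with vertex set 'I_n.                       *)
Definition Gr (n k l : nat) : {set {set {set 'I_n}}} :=
  [set E : {set {set 'I_n}} | simple_graph E
     & [forall C : {set 'I_n}, (#|C| == k) ==> identifying E l C]].

Definition Gr_inhabited (k l : nat) : pred nat :=
  fun n => (k <= n) && (Gr n k l != set0).

Lemma Gr_inhabited_ex (k l : nat) : exists n, Gr_inhabited k l n.
Proof.
exists k; rewrite /Gr_inhabited leqnn; apply/set0Pn; exists set0.
rewrite inE; apply/andP; split; first by apply/forall_inP => e; rewrite inE.
have N0 (X : {set 'I_k}) : clnbrs set0 X = X.
  apply/setP => y; apply/bigcupP/idP => [[x xX]|yX].
    by rewrite !inE orbF => /eqP->.
  by exists y; rewrite // !inE eqxx.
apply/forall_inP => C /eqP cC.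
have -> : C = setT by apply/eqP; rewrite eqEcard subsetT cardsT card_ord cC /=.
apply/forallP => X; apply/forallP => Y; apply/implyP => /and3P[neXY _ _].
by rewrite !setIT !N0.
Qed.

Lemma Gr_inhabited_ub (k l : nat) :
  0 < l -> forall n, Gr_inhabited k l n -> n <= 2 ^ k.
Proof.
move=> l0 n /andP[kn /set0Pn[E]]; rewrite inE => /andP[_ /forall_inP idE].
have [C cC] : exists C : {set 'I_n}, #|C| = k.
  exists [set widen_ord kn i | i : 'I_k].
  by rewrite card_imset ?card_ord // => i j /(congr1 val) /= /val_inj.
have /forallP idC := idE C (introT eqP cC).
pose f (x : 'I_n) := clnbrs E [set x] :&: C.
have f_inj : injective f.
  move=> x y fxy; apply/eqP/negPn/negP => nexy.
  have /forallP/(_ [set y])/implyP := idC [set x].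
  rewrite !cards1 l0 (inj_eq set1_inj) nexy => /(_ isT).
  by rewrite -[X in X != _]/(f x) fxy eqxx.
rewrite -cC -card_powerset -[X in X <= _](card_ord n) -(card_imset _ f_inj).
apply: subset_leq_card; apply/subsetP => _ /imsetP[x _ ->].
by rewrite inE subsetIr.
Qed.

(* The largest n >= k such that Gr n k l is nonempty.  For l = 0 there is no  *)
(* such largest n, whence the hypothesis on l.                                *)
Definition Xi (k l : nat) (l_gt0 : 0 < l) : nat :=
  ex_maxn (Gr_inhabited_ex k l) (Gr_inhabited_ub l_gt0).
Arguments Xi : clear implicits.

(* Main.v *)
(* Put d = n - k + 1.  Every k-set is (1,<=l)-identifying iff N[X] and N[Y]
   differ in at least d vertices for all distinct X and Y of size at most l;
   comparing X with y |: X, a new vertex y brings at least d new vertices to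
   N[X] when |X| < l.  If n > k then d >= 2, so y has at least l - 1
   neighbours, and comparing y with a set Z of l - 1 of them, where
   y |: Z lies in both N[y] and N[Z], gives |N[y]| >= d + l.  Adding l - 1
   further vertices yields n >= (d + l) + (l - 1) d = l (n - k + 2). *)
Require Import Defs.
From mathcomp Require Import all_boot all_order all_algebra.
From mathcomp Require Import zify lra.

Lemma exists_subset_card {T : finType} {A : {set T}} {m : nat} :
  m <= #|A| -> exists2 B : {set T}, B \subset A & #|B| = m.
Proof.
move=> mA; have : 0 < #|[set B : {set T} | B \subset A & #|B| == m]|.
  by rewrite cards_draws bin_gt0.
by case/card_gt0P=> B; rewrite inE => /andP[sBA /eqP cB]; exists B.
Qed.

Lemma clnbr_refl {V : finType} (E : {set {set V}}) x : x \in clnbr E x.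
Proof. by rewrite !inE eqxx. Qed.

Lemma clnbr_sym {V : finType} (E : {set {set V}}) x y :
  (x \in clnbr E y) = (y \in clnbr E x).
Proof. by rewrite !inE eq_sym setUC. Qed.

Lemma sub_clnbrs {V : finType} (E : {set {set V}}) (X : {set V}) :
  X \subset clnbrs E X.
Proof.
by apply/subsetP => x xX; apply/bigcupP; exists x; rewrite ?clnbr_refl.
Qed.

Lemma clnbrsU1 {V : finType} (E : {set {set V}}) y X :
  clnbrs E (y |: X) = clnbr E y :|: clnbrs E X.
Proof. by rewrite /clnbrs bigcup_setU big_set1. Qed.

(** If at most [#|V| - k] vertices of N[y] lay outside N[X], some k-set [C] would avoid them all,
    and [C] could not separate [y |: X] from [X]. *)
Lemma card_new_nbrs {V : finType} {E : {set {set V}}} {k l : nat}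
    {X : {set V}} {y : V} :
    (forall C : {set V}, #|C| = k -> identifying E l C) -> k <= #|V| ->
    #|X| < l -> y \notin X ->
  #|V| - k < #|clnbr E y :\: clnbrs E X|.
Proof.
move=> idE kV ltXl yX; rewrite ltnNge; apply/negP => small.
have : k <= #|~: (clnbr E y :\: clnbrs E X)|.
  by have := cardsC (clnbr E y :\: clnbrs E X); lia.
case/exists_subset_card => C sC /idE/forallP/(_ (y |: X))/forallP/(_ X).
rewrite cardsU1 yX (ltnW ltXl) add1n ltXl !andbT.
have -> : y |: X != X by apply: contraNneq yX => <-; rewrite setU11.
move=> /= /eqP; apply; rewrite clnbrsU1; apply/setP => z.
rewrite !in_setI in_setU; case zC: (z \in C); rewrite ?andbF // !andbT.
have := subsetP sC z zC; rewrite in_setC in_setD negb_and negbK.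
by case: (z \in clnbrs E X); rewrite ?orbT // orbF => /negbTE.
Qed.

Lemma card_clnbr {V : finType} {E : {set {set V}}} {k l : nat} (y : V) :
    (forall C : {set V}, #|C| = k -> identifying E l C) -> k < #|V| -> 1 < l ->
  #|V| - k + l < #|clnbr E y|.
Proof.
move=> idE kV l1; pose N := clnbr E y :\ y.
have new (Z : {set V}) : Z \subset N -> #|Z| < l ->
    #|V| - k < #|clnbr E y :\: clnbrs E Z|.
  move=> sZN ltZl; apply: (card_new_nbrs idE) => //; first exact: ltnW.
  by apply/negP => /(subsetP sZN); rewrite in_setD1 eqxx.
(* Otherwise [Z := N] is admissible in [new]; but N[y] minus N[N] contains at most [y], while
   [k < #|V|] forces at least two new vertices. *)
have deg : l.-1 <= #|N|.
  rewrite leqNgt; apply/negP => ltNl.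
  have : clnbr E y :\: clnbrs E N \subset [set y].
    apply/subsetP => z; rewrite in_setD in_set1 => /andP[zN zy].
    apply: contraNT zN => nzy; apply: (subsetP (sub_clnbrs E N)).
    by rewrite in_setD1 nzy.
  move/subset_leq_card; rewrite cards1.
  by have := new N (subxx _); lia.
have [Z sZN cZ] := exists_subset_card deg.
have yZ : y \notin Z by apply/negP => /(subsetP sZN); rewrite in_setD1 eqxx.
(* These are [l] vertices that [new] does not count; [y] lies in N[Z] because [Z] is nonempty, as
   [1 < l]. *)
have : y |: Z \subset clnbr E y :&: clnbrs E Z.
  rewrite subUset !sub1set !subsetI sub_clnbrs in_setI clnbr_refl andbT /=.
  rewrite (subset_trans sZN (subsetDl _ _)) andbT.
  have /card_gt0P[z zZ] : 0 < #|Z| by lia.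
  apply/bigcupP; exists z => //.
  by have := subsetP sZN z zZ; rewrite in_setD1 clnbr_sym => /andP[].
move/subset_leq_card; rewrite cardsU1 yZ cZ.
by have := new Z sZN; have := cardsID (clnbrs E Z) (clnbr E y); lia.
Qed.

(** Induction on [j]: start from one closed neighbourhood, then each added vertex contributes at
    least [(#|V| - k).+1] new ones. *)
Lemma exists_large_clnbrs {V : finType} {E : {set {set V}}} {k l : nat} j :
    (forall C : {set V}, #|C| = k -> identifying E l C) -> k < #|V| -> 1 < l ->
    j < l ->
  exists2 X : {set V}, #|X| = j.+1
    & #|V| - k + l + j * (#|V| - k).+1 < #|clnbrs E X|.
Proof.
move=> idE kV l1; elim: j => [_|j IHj ltjl].
  have /card_gt0P[y _] : 0 < #|V| by lia.
  exists [set y]; first exact: cards1.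
  by rewrite mul0n addn0 /clnbrs big_set1 card_clnbr.
have [X cX largeX] := IHj (ltnW ltjl).
(* A vertex outside [X] exists since [#|X| < l], and [l] is less than the size of any closed
   neighbourhood. *)
have /card_gt0P[y] : 0 < #|~: X|.
  have /card_gt0P[y _] : 0 < #|V| by lia.
  have := cardsC X; have := card_clnbr y idE kV l1.
  by have := max_card (clnbr E y); lia.
rewrite in_setC => yX; exists (y |: X); first by rewrite cardsU1 yX cX.
have ltXl : #|X| < l by rewrite cX.
have := card_new_nbrs idE (ltnW kV) ltXl yX.
have := cardsID (clnbrs E X) (clnbr E y).
by rewrite clnbrsU1 cardsU; lia.
Qed.

Lemma Gr_bound {n k l : nat} :
  Gr n k l != set0 -> k < n -> 1 < l -> l * (n - k + 2) <= n.
Proof.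
case/set0Pn => E; rewrite inE => /andP[_ /forall_inP idE'] kn l1.
have idE (C : {set 'I_n}) : #|C| = k -> identifying E l C.
  by move=> cC; apply: idE'; apply/eqP.
have kV : k < #|'I_n| by rewrite card_ord.
have ltl : l.-1 < l by lia.
have [X _] := exists_large_clnbrs l.-1 idE kV l1 ltl.
have := max_card (clnbrs E X); rewrite !card_ord.
by nia.
Qed.

Theorem theorem35 (k l : nat) (hk : (1 <= k)%N) (hl : (2 <= l)%N) :
  ((Xi k l (ltnW hl))%:R <=
     Num.max (l%:R / (l%:R - 1) * (k%:R - 2)) k%:R :> rat)%R.
Proof.
rewrite /Xi; case: ex_maxnP => n /andP[kn Gr0] _.
rewrite Order.TotalTheory.le_max !Num.Theory.ler_nat.
have [//|ltkn] := leqP n k; first by rewrite orbT.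
rewrite orbF.
have l1 : (0 < l%:R - 1 :> rat)%R.
  by rewrite Num.Theory.subr_gt0 (Num.Theory.ltr_nat _ 1 l).
rewrite GRing.mulrAC Num.Theory.ler_pdivlMr //.
(* The bound with denominator cleared and no subtraction, so that it can be proved in [nat]; there
   [n - k] is not truncated, as [k < n]. *)
have : (n%:R * l%:R + l%:R * 2 <= n%:R + l%:R * k%:R :> rat)%R.
  rewrite -!GRing.natrM -!GRing.natrD Num.Theory.ler_nat.
  by have := Gr_bound Gr0 ltkn hl; nia.
by lra.
Qed.
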